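(* Let $f: \mathbb{R}^d \rightarrow \mathbb{R}^m$ be the random base mapping (defined in the context). Then: (1) $f(0) = 0$ deterministically, for every $m \ge 1$. (2) There is an absolute constant $c>0$ such that for every $\delta \in (0,1)$, if $m \ge c s^2/\delta$, then for any pair of non-negative $s$-sparse vectors $x,y \in \mathbb{R}^d$ (fixed independently of the randomness of $f$), \[ \Pr\left(\text{for all } p \ge 1,\ \|f(x) - f(y) \|_p = \|x-y\|_p\right) \ge 1-\delta. \] (3) For every $m \ge 1$ and every pair of vectors $x,y \in \mathbb{R}^d$ with non-negative entries (not necessarily sparse), $\|f(x) - f(y)\|_p \le \|x-y\|_p$ deterministically for all $p \ge 1$.
   Context: The base mapping $f: \mathbb{R}^d \rightarrow \mathbb{R}^m$ is defined as follows. Pick a uniformly random function $h: [d] \rightarrow [m]$. For $i \in [m]$ let $S_i = \{ j \in [d] \mid h(j) = i\}$. For $x \in \mathbb{R}^d$, define $f(x)_i = \max\{ x_j \mid j \in S_i\}$ if $S_i \neq \emptyset$ and $f(x)_i = 0$ otherwise. A vector is $s$-sparse if it has at most $s$ non-zero coordinates; it is non-negative if all its coordinates are $\ge 0$. *)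

(* Defs.v *)
From HB Require Import structures.
From mathcomp Require Import all_boot all_order all_algebra.
From mathcomp Require Import all_classical all_reals all_analysis.

Set Implicit Arguments.
Unset Strict Implicit.
Unset Printing Implicit Defensive.

Import Order.TTheory GRing.Theory Num.Theory.
Local Open Scope ring_scope.

(* The index sets [d] and [m] are 'I_d and 'I_m, so a function [d] -> [m] is
   h : {ffun 'I_d -> 'I_m}, and R^d is 'rV[R]_d. *)

Definition bucket (d m : nat) (h : {ffun 'I_d -> 'I_m}) (i : 'I_m) : {set 'I_d} :=
  [set j | h j == i].

(* The iterated maximum is seeded with the coordinate of a member j0 of the
   bucket, not with 0: coordinates may all be negative. *)
Definition base_map (R : realType) (d m : nat) (h : {ffun 'I_d -> 'I_m})
    (x : 'rV[R]_d) : 'rV[R]_m :=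
  \row_(i < m)
    (if [pick j in bucket h i] is Some j0
     then \big[Num.max/x 0 j0]_(j in bucket h i) x 0 j
     else 0).

Definition sparse (R : realType) (d : nat) (s : nat) (x : 'rV[R]_d) : bool :=
  (#|[set j | x 0%R j != 0%R]| <= s)%N.

Definition nonneg (R : realType) (d : nat) (x : 'rV[R]_d) : Prop :=
  forall j, 0 <= x 0 j.

(* The p-norm on R^n for 1 <= p <= +oo; the value at -oo is irrelevant. *)
Definition lp_norm (R : realType) (n : nat) (p : \bar R) (x : 'rV[R]_n) : R :=
  match p with
  | r%:E => (\sum_(i < n) `|x 0 i| `^ r) `^ r^-1
  | +oo%E => \big[Num.max/0]_(i < n) `|x 0 i|
  | -oo%E => 0
  end.

(* Probability of the event A for a uniformly random element of T.  It is a
   probability only for nonempty T; on an empty T it evaluates to 0. *)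
Definition unif_prob (R : realType) (T : finType) (A : T -> Prop) : R :=
  #|[set t : T | `[< A t >]]|%:R / #|T|%:R.

(* Main.v *)
(** Each coordinate of [f x - f y] vanishes or is bounded by the difference
    [x j - y j] at the index [j] attaining the larger of the two maxima, whence
    the contraction.  If [h] is injective on the union [U] of the supports,
    every nonzero [x j - y j] is copied to its own bucket, so the norm is also
    preserved from below.  Since [#|U| <= 2 s] and each of the at most [4 s^2]
    ordered pairs of [U] collides with probability [1 / m], injectivity fails
    with probability at most [4 s^2 / m]. *)

Require Import Defs.
From HB Require Import structures.
From mathcomp Require Import all_boot all_order all_algebra.
From mathcomp Require Import all_classical all_reals all_analysis.

Import Order.TTheory GRing.Theory Num.Theory.
Local Open Scope ring_scope.

Lemma rowB {V : zmodType} {n} (u v : 'rV[V]_n) i : (u - v) 0 i = u 0 i - v 0 i.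
Proof. by rewrite !mxE. Qed.

Section BaseMap.
Context {R : realType} {d m : nat} (h : {ffun 'I_d -> 'I_m}).
Implicit Types (x y : 'rV[R]_d) (i : 'I_m) (j : 'I_d) (p : \bar R).

(** Nonnegativity lets 0 seed the maximum: it never exceeds a maximum over a nonempty bucket, and it
    is the prescribed value on an empty one, so both cases become one formula. *)
Lemma base_map_bigmax x i : nonneg x ->
  base_map h x 0 i = \big[Num.max/0]_(j | h j == i) x 0 j.
Proof.
move=> x_ge0; rewrite mxE; case: pickP => [j0|bucket0].
  rewrite inE => hj0; under eq_bigl do rewrite inE.
  apply/le_anti/andP; split; apply: bigmax_le => // [|j hj].
  - exact: (bigmax_sup j0).
  - exact: (bigmax_sup j).
  - exact: (bigmax_sup j0).
  - exact: (bigmax_sup j).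
rewrite big_pred0// => j; have := bucket0 j.
by rewrite inE.
Qed.

Lemma base_map_ge0 x i : nonneg x -> 0 <= base_map h x 0 i.
Proof. by move=> x_ge0; rewrite base_map_bigmax ?bigmax_ge_id. Qed.

Lemma le_base_map x j : nonneg x -> x 0 j <= base_map h x 0 (h j).
Proof. by move=> x_ge0; rewrite base_map_bigmax//; apply: (bigmax_sup j). Qed.

Lemma base_map_attained x i : nonneg x ->
  base_map h x 0 i = 0 \/ exists2 j, h j = i & base_map h x 0 i = x 0 j.
Proof.
move=> x_ge0; rewrite base_map_bigmax//.
case: (pickP (fun j => h j == i)) => [j0 hj0|bucket0]; last first.
  by left; rewrite big_pred0.
have [j /eqP hj ->] :=
  eq_bigmax j0 (fun j => h j == i) (x 0) hj0 (fun j _ => x_ge0 j).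
by right; exists j.
Qed.

Lemma base_map_sub_bounded x y i : nonneg x -> nonneg y ->
  (base_map h x - base_map h y) 0 i = 0 \/
  exists2 j, h j = i &
    `|(base_map h x - base_map h y) 0 i| <= `|(x - y) 0 j|.
Proof.
move=> x_ge0 y_ge0; rewrite !rowB.
wlog le_yx : x y x_ge0 y_ge0 / base_map h y 0 i <= base_map h x 0 i.
  move=> gen; have [|/ltW] := leP (base_map h y 0 i) (base_map h x 0 i).
    exact: gen.
  move=> /(gen y x y_ge0 x_ge0)[/eqP|[j hj le_j]].
    by rewrite subr_eq0 => /eqP ->; left; rewrite subrr.
  right; exists j => //; rewrite distrC (le_trans le_j)// !rowB.
  by rewrite distrC.
(* If the larger maximum is 0, both are 0. Otherwise it is some [x 0 j], and [y 0 j] is at most the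
   maximum of [y] over the same bucket. *)
case: (base_map_attained x i x_ge0) => [fx0|[j hj fxj]].
  left; apply/le_anti; rewrite subr_ge0 le_yx subr_le0 fx0.
  by rewrite base_map_ge0.
right; exists j => //; rewrite ger0_norm ?subr_ge0// fxj -hj !rowB.
by rewrite (le_trans _ (ler_norm _))// lerB// le_base_map.
Qed.

(** The bucket of [j] meets [U] only in [j], so its other entries are zeros, which cannot exceed
    [x 0 j]. *)
Lemma base_map_inj_supp (U : {set 'I_d}) x j : nonneg x ->
  (forall k, x 0 k != 0 -> k \in U) -> {in U &, injective h} ->
  j \in U -> base_map h x 0 (h j) = x 0 j.
Proof.
move=> x_ge0 suppU hinj jU; apply/le_anti/andP; split; last exact: le_base_map.
rewrite base_map_bigmax//; apply: bigmax_le => // k /eqP hkj.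
have [->//|/suppU kU] := eqVneq (x 0 k) 0.
by rewrite (hinj k j).
Qed.

(** The fibers of [h] partition the indices of [v], so distinct [i] are charged to distinct [j] and
    no term of [v] is used twice. *)
Lemma lp_norm_fiber_le p (u : 'rV[R]_m) (v : 'rV[R]_d) : (1 <= p)%E ->
  (forall i, u 0 i = 0 \/ exists2 j, h j = i & `|u 0 i| <= `|v 0 j|) ->
  lp_norm p u <= lp_norm p v.
Proof.
case: p => [r| |//] p_ge1 u_le /=; last first.
  apply: bigmax_le => [|i _]; first exact: bigmax_ge_id.
  case: (u_le i) => [->|[j _ le_uv]]; first by rewrite normr0 bigmax_ge_id.
  exact: (bigmax_sup j).
have r_gt0 : 0 < r by rewrite (lt_le_trans ltr01)// -lee_fin.
apply: ge0_ler_powR; first by rewrite invr_ge0 ltW.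
1,2: by rewrite nnegrE sumr_ge0// => *; exact: powR_ge0.
rewrite [leRHS](partition_big h predT)//=; apply: ler_sum => i _.
have fib_ge0 (P : pred 'I_d) : 0 <= \sum_(j | P j) `|v 0 j| `^ r.
  by apply: sumr_ge0 => j _; exact: powR_ge0.
(* A zero entry contributes 0 only because [r] is nonzero: the power of 0 with exponent 0 is 1. *)
case: (u_le i) => [->|[j hj le_uv]]; first by rewrite normr0 powR0 ?gt_eqF.
rewrite (bigD1 j) ?hj//= (le_trans (ge0_ler_powR (ltW r_gt0) _ _ le_uv))//.
by rewrite lerDl.
Qed.

(** By injectivity the sum over [U] reindexes to a sum over [h @: U], which is part of the sum for
    [u]; the terms left out are nonnegative. *)
Lemma lp_norm_inj_supp_le p (u : 'rV[R]_m) (v : 'rV[R]_d) (U : {set 'I_d}) :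
  (1 <= p)%E -> (forall j, v 0 j != 0 -> j \in U) -> {in U &, injective h} ->
  (forall j, j \in U -> u 0 (h j) = v 0 j) -> lp_norm p v <= lp_norm p u.
Proof.
case: p => [r| |//] p_ge1 suppU hinj uv /=; last first.
  apply: bigmax_le => [|j _]; first exact: bigmax_ge_id.
  have [->|/suppU/uv <-] := eqVneq (v 0 j) 0; first by rewrite normr0 bigmax_ge_id.
  exact: (bigmax_sup (h j)).
have r_gt0 : 0 < r by rewrite (lt_le_trans ltr01)// -lee_fin.
apply: ge0_ler_powR; first by rewrite invr_ge0 ltW.
1,2: by rewrite nnegrE sumr_ge0// => *; exact: powR_ge0.
rewrite (bigID (mem U))/= [X in _ + X]big1 ?addr0; last first.
  by move=> j; apply: contraNeq => vj; apply: suppU; apply: contra_neq vj => ->;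
     rewrite normr0 powR0 ?gt_eqF.
under eq_bigr => j jU do rewrite -uv//.
rewrite -(big_imset (fun i => `|u 0 i| `^ r) hinj)/=.
by rewrite [leRHS](bigID (mem (h @: U)))/= lerDl sumr_ge0// => i _; exact: powR_ge0.
Qed.

Lemma lp_norm_base_map_le p x y : (1 <= p)%E -> nonneg x -> nonneg y ->
  lp_norm p (base_map h x - base_map h y) <= lp_norm p (x - y).
Proof.
by move=> p1 x0 y0; apply: lp_norm_fiber_le => // i; exact: base_map_sub_bounded.
Qed.

Lemma lp_norm_base_map_inj p x y (U : {set 'I_d}) :
  (1 <= p)%E -> nonneg x -> nonneg y ->
  (forall j, x 0 j != 0 -> j \in U) -> (forall j, y 0 j != 0 -> j \in U) ->
  {in U &, injective h} ->
  lp_norm p (base_map h x - base_map h y) = lp_norm p (x - y).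
Proof.
move=> p1 x0 y0 xU yU hinj; apply/le_anti; rewrite lp_norm_base_map_le//=.
apply: (@lp_norm_inj_supp_le _ _ _ U) => // j.
  apply: contraNT => jU; rewrite rowB.
  have /eqP -> : x 0 j == 0 by apply: contraNT jU; exact: xU.
  have /eqP -> : y 0 j == 0 by apply: contraNT jU; exact: yU.
  by rewrite subrr.
by move=> jU; rewrite !rowB !(base_map_inj_supp U).
Qed.

End BaseMap.

Lemma card_collision_le (T S : finType) (j k : T) : j != k ->
  (#|[set h : {ffun T -> S} | h j == h k]| * #|S| <= #|{ffun T -> S}|)%N.
Proof.
move=> neq_jk; set A := [set h | _].
rewrite -[#|S|]cardsT -cardsX.
(* Overwriting the value at [j] loses nothing: it is still the value at [k]. *)
pose g (q : {ffun T -> S} * S) := [ffun a => if a == j then q.2 else q.1 a].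
apply: (@leq_card_in _ _ g) => -[h1 s1] [h2 s2]; rewrite !inE/= !andbT.
move=> /eqP h1jk /eqP h2jk /ffunP eg.
have eq_off a : a != j -> h1 a = h2 a.
  by move=> aj; have := eg a; rewrite !ffunE (negPf aj).
congr pair; last by have := eg j; rewrite !ffunE eqxx.
apply/ffunP => a; have [->|/eq_off//] := eqVneq a j.
by rewrite h1jk h2jk eq_off// eq_sym.
Qed.

(** Union bound over the ordered pairs of distinct elements of [U], with denominators cleared so
    that the count stays in [nat]. *)
Lemma card_noninjective_le (T S : finType) (U : {set T}) :
  (#|[set h : {ffun T -> S} | ~~ `[< {in U &, injective h} >]]| * #|S| <=
   #|U| ^ 2 * #|{ffun T -> S}|)%N.
Proof.
set B := [set h | _].
pose C (q : T * T) := [set h : {ffun T -> S} | h q.1 == h q.2].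
pose P := [pred q in finset.setX U U | q.1 != q.2].
have /subset_leq_card B_le : B \subset (\bigcup_(q | P q) C q)%SET.
  apply/fintype.subsetP => h; rewrite inE => noninj.
  apply: contraNT noninj => noC; apply/asboolP => j k jU kU hjk.
  apply: contraNeq noC => neq_jk; apply/finset.bigcupP; exists (j, k).
    by rewrite /= !inE/= jU kU.
  by rewrite inE/= hjk.
have {}B_le : (#|B| <= \sum_(q | P q) #|C q|)%N.
  apply: (leq_trans B_le).
  elim/big_rec2: _ => [|q n D _ IH]; first by rewrite cards0.
  by rewrite (leq_trans (leq_card_setU _ _))// leq_add2l.
rewrite (leq_trans (leq_mul B_le (leqnn _)))// big_distrl/=.
apply: (@leq_trans (\sum_(q | P q) #|{ffun T -> S}|)%N).
  by apply: leq_sum => q /andP[_ neq_q]; exact: card_collision_le.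
rewrite sum_nat_const leq_mul2r; apply/orP; right.
rewrite -mulnn -cardsX; apply: subset_leq_card; apply/fintype.subsetP => q.
by case/andP.
Qed.

(** [B] only has to contain the failures of [A], so an upper bound on the size of a simpler bad set
    suffices. *)
Lemma unif_prob_ge (R : realType) (T : finType) (A : T -> Prop) (B : {set T})
    (e : R) :
  (0 < #|T|)%N -> (forall t, t \notin B -> A t) ->
  #|B|%:R <= e * #|T|%:R -> 1 - e <= unif_prob R A.
Proof.
move=> T_gt0 BA B_le; have TR_gt0 : 0 < #|T|%:R :> R by rewrite ltr0n.
rewrite /unif_prob ler_pdivlMr// mulrBl mul1r lerBlDr.
apply: (@le_trans _ _ (#|[set t : T | `[< A t >]]|%:R + #|B|%:R)); last first.
  by rewrite lerD2l.
rewrite -natrD ler_nat -[leqLHS](cardsC B) addnC leq_add2r.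
apply/subset_leq_card/fintype.subsetP => t; rewrite !inE.
exact: BA.
Qed.

Theorem mainTheorem6 (R : realType) :
  (forall (d m : nat) (h : {ffun 'I_d -> 'I_m}),
     (1 <= m)%N -> base_map h (0 : 'rV[R]_d) = 0) /\
  (exists c : R, 0 < c /\
     forall (delta : R) (s d m : nat),
       0 < delta < 1 -> (1 <= m)%N -> c * s%:R ^+ 2 / delta <= m%:R ->
       forall x y : 'rV[R]_d,
         nonneg x -> nonneg y -> sparse s x -> sparse s y ->
         1 - delta <=
         unif_prob R (fun h : {ffun 'I_d -> 'I_m} =>
           forall p : \bar R, (1 <= p)%E ->
             lp_norm p (base_map h x - base_map h y) = lp_norm p (x - y))) /\
  (forall (d m : nat) (h : {ffun 'I_d -> 'I_m}) (x y : 'rV[R]_d),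
     (1 <= m)%N -> nonneg x -> nonneg y ->
     forall p : \bar R, (1 <= p)%E ->
       lp_norm p (base_map h x - base_map h y) <= lp_norm p (x - y)).
Proof.
split; [|split].
- move=> d m h _; apply/rowP => i.
  have nn0 : nonneg (0 : 'rV[R]_d) by move=> j; rewrite mxE.
  by case: (base_map_attained h 0 i nn0) => [->|[j _ ->]]; rewrite !mxE.
- exists 4; split=> // delta s d m /andP[delta_gt0 _] m_gt0 m_ge x y x0 y0 sx sy.
  pose U := [set j | x 0 j != 0] :|: [set j | y 0 j != 0].
  have xU j : x 0 j != 0 -> j \in U by move=> xj; rewrite !inE xj.
  have yU j : y 0 j != 0 -> j \in U by move=> yj; rewrite !inE yj orbT.
  have cardU : (#|U| <= 2 * s)%N.
    by rewrite (leq_trans (leq_card_setU _ _))// mul2n -addnn leq_add.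
  have T_gt0 : (0 < #|{ffun 'I_d -> 'I_m}|)%N.
    by rewrite card_ffun !card_ord expn_gt0 m_gt0.
  (* The bad set does not mention [p], so one good [h] serves all norms at once. *)
  apply: (@unif_prob_ge _ _ _
    [set h : {ffun 'I_d -> 'I_m} | ~~ `[< {in U &, injective h} >]]) => //.
    move=> h; rewrite inE negbK => /asboolP hinj p p1.
    exact: (lp_norm_base_map_inj h p x y U).
  have := card_noninjective_le 'I_d 'I_m U; rewrite card_ord.
  (* With [b] bad functions out of [t], the goal [b <= delta * t] is multiplied by [m] and follows
     from [b * m <= 4 * s ^ 2 * t] and [4 * s ^ 2 <= m * delta]. *)
  move: (#|_|)%N (#|{ffun _ -> _}|)%N T_gt0 => b t t_gt0 b_le.
  have {}b_le : (b * m <= 4 * s ^ 2 * t)%N.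
    apply: (leq_trans b_le); rewrite leq_mul2r; apply/orP; right.
    by rewrite -[4%N]/(2 ^ 2)%N -expnMn leq_exp2r.
  rewrite ler_pdivrMr// in m_ge.
  have mR_gt0 : 0 < m%:R :> R by rewrite ltr0n.
  rewrite -(ler_pM2r mR_gt0) -natrM.
  apply: (@le_trans _ _ ((4 * s ^ 2 * t)%:R)); first by rewrite ler_nat.
  by rewrite 2!natrM natrX [leRHS]mulrAC [delta * _]mulrC ler_wpM2r.
- by move=> d m h x y _ x0 y0 p p1; exact: lp_norm_base_map_le.
Qed.
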